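(* Let $\{X_{t}\}$ be a second order stationary, zero mean time series with spectral density $f$ which is bounded away from zero and whose autocovariance satisfies $\sum_{r\in\mathbb{Z}}|r\,c_{f}(r)|<\infty$. Let $\underline{X}_n=(X_1,\ldots,X_n)'$, let $\widehat{X}_{\tau,n}=\sum_{t=1}^{n}\phi_{t,n}(\tau;f)X_t$ denote the best linear predictor of $X_\tau$ given $\underline{X}_n$, and let $D_n(f)$ be the $n\times n$ matrix with entries $$D_{n}(f)_{k,t}= n^{-1/2}\sum_{\tau\leq 0}\left(\phi_{t,n}(\tau;f)e^{i\tau\omega_{k,n}}+\phi_{n+1-t,n}(\tau;f)e^{-i(\tau-1)\omega_{k,n}}\right),\qquad 1\le k,t\le n .$$ Then $$\mathrm{cov}_{f}\big((F_{n}+D_{n}(f))\underline{X}_{n},\,F_{n}\underline{X}_{n}\big)=\Delta_{n}(f).$$ Entrywise, for $1\le k_1,k_2\le n$, $$\mathrm{cov}_{f}\left(\widetilde{J}_{n}(\omega_{k_1,n};f),\,J_{n}(\omega_{k_2,n})\right)=f(\omega_{k_1,n})\,\delta_{k_1,k_2},$$ where $\widetilde{J}_{n}(\omega;f)=J_{n}(\omega)+\widehat{J}_{n}(\omega;f)$ and $$\widehat{J}_{n}(\omega;f)=n^{-1/2}\sum_{\tau\leq 0}\widehat{X}_{\tau,n}e^{i\tau\omega}+n^{-1/2}\sum_{\tau>n}\widehat{X}_{\tau,n}e^{i\tau\omega}.$$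
   Context: Time series are real-valued. $c_f(r)=\mathrm{cov}_f(X_t,X_{t+r})$ is the autocovariance and $f(\omega)=\sum_{r\in\mathbb{Z}}c_f(r)e^{ir\omega}$ the spectral density; the subscript $f$ on $\mathrm{cov}$ and $\mathbb{E}$ indicates that the time series has spectral density $f$. For zero mean complex random vectors, $\mathrm{cov}(Y,Z)=\mathbb{E}[YZ^{*}]$ with $*$ the conjugate transpose. Put $\omega_{k,n}=2\pi k/n$. $F_n$ is the $n\times n$ matrix with entries $(F_n)_{k,t}=n^{-1/2}e^{it\omega_{k,n}}$, $\Delta_n(g)=\mathrm{diag}(g(\omega_{1,n}),\ldots,g(\omega_{n,n}))$, and $J_n(\omega)=n^{-1/2}\sum_{t=1}^{n}X_te^{it\omega}$. $\delta_{k_1,k_2}=1$ if $k_1=k_2$ and $0$ otherwise. For $\tau\le 0$ and $\tau>n$, $\{\phi_{t,n}(\tau;f)\}_{t=1}^n$ are the coefficients minimizing $\mathbb{E}_f[X_\tau-\sum_{t=1}^{n}\phi_{t,n}(\tau;f)X_t]^2$ (they depend only on $c_f$). *)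

(* Defs.v *)
From HB Require Import structures.
From mathcomp Require Import all_boot all_order all_algebra.
From mathcomp Require Import all_classical all_reals all_analysis.
From mathcomp Require Import complex.

Set Implicit Arguments.
Unset Strict Implicit.
Unset Printing Implicit Defensive.

Import Order.TTheory GRing.Theory Num.Theory.
Import numFieldNormedType.Exports.

Local Open Scope classical_set_scope.
Local Open Scope ring_scope.
Local Open Scope complex_scope.
Local Open Scope sesquilinear_scope.

(* Complex series converge in the norm topology of [R[i]^o]; [csum] is
   meaningful only when [is_cvg_csum] holds. *)
Definition is_cvg_csum (R : realType) (u : nat -> R[i]) : Prop :=
  cvgn (series (u : nat -> (R[i])^o)).

Definition csum (R : realType) (u : nat -> R[i]) : R[i] :=
  limn (series (u : nat -> (R[i])^o)).

Definition tail_nonpos (U : Type) (u : int -> U) : nat -> U :=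
  fun j => u (- j%:Z).

Definition tail_gt (U : Type) (n : nat) (u : int -> U) : nat -> U :=
  fun j => u (n.+1 + j)%:Z.

(* The sum over all integers is split as [r <= 0] and [r > 0]; it is only used
   for absolutely summable families. *)
Definition csumZ (R : realType) (u : int -> R[i]) : R[i] :=
  csum (tail_nonpos u) + csum (tail_gt 0 u).

Definition expi (R : realType) (x : R) : R[i] := cos x +i* sin x.

(* Rows, columns and frequencies run over 1..n: the index [k : 'I_n] stands for
   the integer [k.+1]. *)
Definition omega (R : realType) (n : nat) (k : 'I_n) : R :=
  2 * pi * k.+1%:R / n%:R.

Definition rsqrtn (R : realType) (n : nat) : R[i] :=
  ((Num.sqrt (n%:R : R))^-1)%:C.

Definition cexpectation d (T : measurableType d) (R : realType)
    (P : probability T R) (Y : T -> R[i]) : R[i] :=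
  fine ('E_P[fun x => complex.Re (Y x)])%E
  +i* fine ('E_P[fun x => complex.Im (Y x)])%E.

(* Covariances of zero mean complex variables and vectors, hence no centring. *)
Definition ccov d (T : measurableType d) (R : realType)
    (P : probability T R) (Y Z : T -> R[i]) : R[i] :=
  cexpectation P (fun x => Y x * (Z x)^*).

Definition ccov_mx d (T : measurableType d) (R : realType)
    (P : probability T R) (m n : nat)
    (Y : T -> 'cV[R[i]]_m) (Z : T -> 'cV[R[i]]_n) : 'M[R[i]]_(m, n) :=
  \matrix_(i, j) cexpectation P (fun x => (Y x *m (Z x)^t*) i j).

Definition second_order_stationary d (T : measurableType d) (R : realType)
    (P : probability T R) (X : int -> {RV P >-> R}) : Prop :=
  [/\ forall t, (X t : T -> R) \in Lfun P 2%:E,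
      forall s t, ('E_P[X s] = 'E_P[X t])%E &
      forall s t r,
        covariance P (X s) (X (s + r)) = covariance P (X t) (X (t + r))].

(* Independent of the base point 0 for a second order stationary series. *)
Definition autocov d (T : measurableType d) (R : realType)
    (P : probability T R) (X : int -> {RV P >-> R}) (r : int) : R :=
  fine (covariance P (X 0) (X r)).

Definition is_spectral_density (R : realType) (c : int -> R) (f : R -> R) :
    Prop :=
  forall w, (f w)%:C = csumZ (fun r => (c r)%:C * expi (r%:~R * w)).

Definition lincomb d (T : measurableType d) (R : realType)
    (P : probability T R) (X : int -> {RV P >-> R}) (n : nat)
    (a : 'I_n -> R) (x : T) : R :=
  \sum_(t < n) a t * X t.+1%:Z x.

(* [a] minimizes the mean squared error for predicting [X tau] from
   [X 1, ..., X n]. *)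
Definition best_linear_coef d (T : measurableType d) (R : realType)
    (P : probability T R) (X : int -> {RV P >-> R}) (n : nat)
    (tau : int) (a : 'I_n -> R) : Prop :=
  forall b : 'I_n -> R,
    ('E_P[fun x => ((X tau x - lincomb X a x) ^+ 2)%R]
     <= 'E_P[fun x => ((X tau x - lincomb X b x) ^+ 2)%R])%E.

Definition sample d (T : measurableType d) (R : realType)
    (P : probability T R) (X : int -> {RV P >-> R}) (n : nat) (x : T) :
    'cV[R[i]]_n :=
  \col_(t < n) (X t.+1%:Z x)%:C.

Definition Fmx (R : realType) (n : nat) : 'M[R[i]]_n :=
  \matrix_(k, t) (rsqrtn R n * expi (t.+1%:R * omega R k)).

Definition Deltamx (R : realType) (n : nat) (g : R -> R) : 'M[R[i]]_n :=
  diag_mx (\row_k (g (omega R k))%:C).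

(* [rev_ord t] is the 0-based index of the coefficient n+1-t. *)
Definition Dterm (R : realType) (n : nat) (phi : int -> 'I_n -> R)
    (k t : 'I_n) (tau : int) : R[i] :=
  (phi tau t)%:C * expi (tau%:~R * omega R k)
  + (phi tau (rev_ord t))%:C * expi (- ((tau - 1)%:~R * omega R k)).

Definition Dmx (R : realType) (n : nat) (phi : int -> 'I_n -> R) :
    'M[R[i]]_n :=
  \matrix_(k, t) (rsqrtn R n * csum (tail_nonpos (Dterm phi k t))).

Definition J d (T : measurableType d) (R : realType)
    (P : probability T R) (X : int -> {RV P >-> R}) (n : nat)
    (w : R) (x : T) : R[i] :=
  rsqrtn R n * \sum_(t < n) (X t.+1%:Z x)%:C * expi (t.+1%:R * w).

Definition Jhat_term d (T : measurableType d) (R : realType)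
    (P : probability T R) (X : int -> {RV P >-> R}) (n : nat)
    (phi : int -> 'I_n -> R) (w : R) (x : T) (tau : int) : R[i] :=
  (lincomb X (phi tau) x)%:C * expi (tau%:~R * w).

(* The two series are summed pointwise on the sample space. *)
Definition Jhat d (T : measurableType d) (R : realType)
    (P : probability T R) (X : int -> {RV P >-> R}) (n : nat)
    (phi : int -> 'I_n -> R) (w : R) (x : T) : R[i] :=
  rsqrtn R n * csum (tail_nonpos (Jhat_term X phi w x))
  + rsqrtn R n * csum (tail_gt n (Jhat_term X phi w x)).

Definition Jtilde d (T : measurableType d) (R : realType)
    (P : probability T R) (X : int -> {RV P >-> R}) (n : nat)
    (phi : int -> 'I_n -> R) (w : R) (x : T) : R[i] :=
  J X n w x + Jhat X phi w x.

(* Main.v *)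
Require Import Defs.
From HB Require Import structures.
From mathcomp Require Import all_boot all_order all_algebra.
From mathcomp Require Import all_classical all_reals all_analysis.
From mathcomp Require Import complex.
From mathcomp Require Import ring lra zify.

Set Implicit Arguments.
Unset Strict Implicit.
Unset Printing Implicit Defensive.

Import Order.TTheory GRing.Theory Num.Theory.
Import numFieldNormedType.Exports.

Local Open Scope classical_set_scope.
Local Open Scope ring_scope.
Local Open Scope complex_scope.

(** The argument is a duality between prediction and the spectral density.
    Write [c] for the autocovariance.  For a time [tau] outside [1..n], the
    normal equations say that the predictor of [X tau] has the same covariance
    [c (tau - t)] with each observed [X t] as [X tau] itself; for [tau] inside
    [1..n] the observation is its own predictor.  Hence the Fourier transform of
    the series completed by its predictors, over all integer times, has
    covariance with [X t] equal to the sum of [c (tau - t) e^{i tau w}] over all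
    [tau], which is [e^{i t w} f(w)] ([predictor_series]).  Taking the discrete
    Fourier transform in [t] and using that the [n]-th roots of unity are
    orthogonal ([sum_expi_omega]) leaves [f] on the diagonal and zero elsewhere.

    The series over [tau] have to converge, which needs the Gram matrix
    [c (j - t)] to be invertible ([gram_unit]): the coefficients are then fixed
    linear combinations of [c (tau - 1), ..., c (tau - n)], and these are
    summable in [tau].  Invertibility is obtained without integrating the
    spectral density.  If a combination [Y] of [X 1, ..., X n] has zero second
    moment, then its covariance with [X r] vanishes for every integer [r]
    ([mom_minimal]), i.e. the convolution of the coefficients with [c] is zero.
    By taking Fourier series, the trigonometric polynomial of the coefficients
    times [f] is zero; as [f] never vanishes, the polynomial does, and so do its
    coefficients ([expi_omega_inj]).

    Finally, the matrix [Dmx] only refers to times [tau <= 0].  It describes the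
    two-sided completion because time reversal maps the prediction problem for
    [tau] to the one for [n + 1 - tau] ([normal_eqs_rev], [phi_rev]), and
    [e^{i n w} = 1] at the Fourier frequencies. *)

(** * Convergent complex series *)

(** An inductive wrapper rather than a definition, so that the convergence
    statement is never unfolded when two sums are compared. *)
Variant has_csum (R : realType) (u : nat -> R[i]) (S : R[i]) : Prop :=
  HasCsum of series (u : nat -> (R[i])^o) @ \oo --> (S : (R[i])^o).

Section ComplexSeries.
Context {R : realType}.
Implicit Types (u v : nat -> R[i]) (S : R[i]).

Lemma has_csum_cvg u S : has_csum u S -> is_cvg_csum u.
Proof. by case=> uS; apply/cvg_ex; exists S. Qed.

Lemma has_csum_val u S : has_csum u S -> csum u = S.
Proof. by case=> uS; rewrite /csum; exact: (cvg_lim (@norm_hausdorff _ _) uS). Qed.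

Lemma has_csum_unique u S S' : has_csum u S -> has_csum u S' -> S = S'.
Proof. by move=> /has_csum_val <- /has_csum_val. Qed.

Lemma eq_has_csum u v S : u =1 v -> has_csum u S -> has_csum v S.
Proof. by move=> /funext ->. Qed.

Lemma has_csumD u v S S' :
  has_csum u S -> has_csum v S' -> has_csum (fun j => u j + v j) (S + S').
Proof.
move=> [uS] [vS']; constructor; have -> :
  series ((fun j => u j + v j) : nat -> (R[i])^o)
    = series (u : nat -> (R[i])^o) + series (v : nat -> (R[i])^o).
  by apply/funext => m; rewrite /series /= big_split.
exact: (@cvgD _ (R[i])^o _ _ _ _ _ _ _ uS vS').
Qed.

Lemma has_csumMl a u S : has_csum u S -> has_csum (fun j => a * u j) (a * S).
Proof.
move=> [uS]; constructor; have -> :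
  series ((fun j => a * u j) : nat -> (R[i])^o)
    = (fun m => a *: series (u : nat -> (R[i])^o) m).
  by apply/funext => m; rewrite /series /= scaler_sumr.
exact: cvgZl_tmp.
Qed.

Lemma has_csum0 : has_csum (fun=> 0) (0 : R[i]).
Proof.
constructor; have -> : series ((fun=> 0) : nat -> (R[i])^o) = (fun=> 0).
  by apply/funext => m; rewrite /series /= big1.
exact: cvg_cst.
Qed.

Lemma has_csum_sum (I : Type) (r : seq I) (u : I -> nat -> R[i]) (S : I -> R[i]) :
  (forall i, has_csum (u i) (S i)) ->
  has_csum (fun j => \sum_(i <- r) u i j) (\sum_(i <- r) S i).
Proof.
move=> uS; elim: r => [|i r IHr].
  rewrite big_nil; apply: eq_has_csum has_csum0 => j; by rewrite big_nil.
rewrite big_cons; apply: eq_has_csum (has_csumD (uS i) IHr) => j.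
by rewrite big_cons.
Qed.

Lemma has_csum_drop m u S : has_csum u S ->
  has_csum (fun j => u (m + j)%N) (S - \sum_(i < m) u i).
Proof.
move=> [uS]; constructor; have -> :
  series ((fun j => u (m + j)%N) : nat -> (R[i])^o)
    = (fun j => series (u : nat -> (R[i])^o) (j + m)%N - \sum_(i < m) u i).
  apply/funext => j; rewrite /series /= addnC !big_mkord big_split_ord /=.
  by rewrite addrAC subrr add0r.
by apply: cvgB; [rewrite cvg_shiftn | exact: cvg_cst].
Qed.

Lemma has_csum_cons u S :
  has_csum (fun j => u j.+1) S -> has_csum u (u 0%N + S).
Proof.
move=> [uS]; constructor; rewrite -(cvg_shiftS (series (u : nat -> (R[i])^o))).
have -> : [sequence series (u : nat -> (R[i])^o) j.+1]_j
    = (fun j => u 0%N + series ((fun j => u j.+1) : nat -> (R[i])^o) j).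
  by apply/funext => j; rewrite /series /= !big_mkord big_ord_recl.
exact: (@cvgD _ (R[i])^o _ _ _ _ _ _ _ (@cvg_cst (R[i])^o _ _ _ _) uS).
Qed.

(** The complex modulus is at most [e] when both parts are at most [e / 2]:
    [e^2 / 4 + e^2 / 4 < e^2]. *)
Lemma has_csum_ReIm (a b : R ^nat) : cvgn (series a) -> cvgn (series b) ->
  exists S, has_csum (fun j => a j +i* b j) S.
Proof.
move=> /cvg_ex[/= A aA] /cvg_ex[/= B bB]; exists (A +i* B).
constructor; have -> : series ((fun j => a j +i* b j) : nat -> (R[i])^o)
    = (fun m => series a m +i* series b m).
  apply/funext => m; rewrite /series /= !big_mkord.
  elim: m => [|m IHm]; first by rewrite !big_ord0.
  by rewrite !big_ord_recr /= IHm.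
apply/cvgrPdist_lt => -[e e'] e_gt0.
have /andP[/eqP /= e'0 /= e_gt0'] : (e' == 0) && (0 < e) by move: e_gt0; rewrite ltcE.
rewrite e'0 {e_gt0 e' e'0}.
have e2 : 0 < e / 2 by rewrite divr_gt0.
move/cvgrPdist_lt : aA => /(_ _ e2) aA; move/cvgrPdist_lt : bB => /(_ _ e2) bB.
near=> m.
rewrite normc_def /= ltcR.
have : `|A - series a m| < e / 2 by near: m.
have : `|B - series b m| < e / 2 by near: m.
move: (A - _) (B - _) => x y; rewrite !ltr_norml => /andP[y1 y2] /andP[x1 x2].
rewrite -(@gtr0_norm _ e)// -sqrtr_sqr ltr_sqrt ?exprn_gt0//; nra.
Unshelve. all: by end_near. Qed.

Lemma expiD (x y : R) : expi (x + y) = expi x * expi y.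
Proof.
rewrite /expi cosD sinD; simpc; congr (_ +i* _).
by rewrite addrC mulrC [X in _ + X]mulrC.
Qed.

Lemma expi0 : expi 0 = 1 :> R[i].
Proof. by rewrite /expi cos0 sin0. Qed.

(** Multiplying by [cos] or [sin] does not increase absolute values, so both
    real series are dominated by the absolute values of the coefficients. *)
Lemma has_csum_expi (c w : R ^nat) : cvgn [normed series c] ->
  exists S, has_csum (fun j => (c j)%:C * expi (w j)) S.
Proof.
move=> c_cvg.
have dom (g : R -> R) : (forall x, `|g x| <= 1) ->
    cvgn (series (fun j => c j * g (w j))).
  move=> g1; apply: normed_cvg.
  apply: (series_le_cvg _ _ _ c_cvg) => j //=.
  by rewrite normrM ler_piMr.
have [//|//|S HS] := has_csum_ReIm (dom cos _) (dom sin _).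
- by move=> x; rewrite ler_norml cos_geN1 cos_le1.
- by move=> x; rewrite ler_norml sin_geN1 sin_le1.
exists S; apply: eq_has_csum HS => j; rewrite /expi; by simpc.
Qed.

End ComplexSeries.

(** * Series over the integers *)

(** Shifting the index moves terms from one half of the line to the other, so
    only the value [S] of the whole sum is recorded and the value [L] of the left
    half is left existential. *)
Definition has_csumZ (R : realType) (u : int -> R[i]) (S : R[i]) : Prop :=
  exists L, has_csum (tail_nonpos u) L /\ has_csum (tail_gt 0 u) (S - L).

Section IntegerSeries.
Context {R : realType}.
Implicit Types (u v : int -> R[i]) (S : R[i]).

Lemma has_csumZ_val u S : has_csumZ u S -> csumZ u = S.
Proof.
by case=> L [uL uR]; rewrite /csumZ (has_csum_val uL) (has_csum_val uR) addrC subrK.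
Qed.

Lemma eq_has_csumZ u v S : u =1 v -> has_csumZ u S -> has_csumZ v S.
Proof. by move=> /funext ->. Qed.

Lemma has_csumZ_unique u S S' : has_csumZ u S -> has_csumZ u S' -> S = S'.
Proof. by move=> /has_csumZ_val <- /has_csumZ_val. Qed.

Lemma has_csumZMl a u S : has_csumZ u S -> has_csumZ (fun r => a * u r) (a * S).
Proof.
case=> L [uL uR]; exists (a * L); split; first exact: has_csumMl.
by rewrite -mulrBr; exact: has_csumMl.
Qed.

Lemma has_csumZ_sum (I : Type) (s : seq I) (u : I -> int -> R[i]) (S : I -> R[i]) :
  (forall i, has_csumZ (u i) (S i)) ->
  has_csumZ (fun r => \sum_(i <- s) u i r) (\sum_(i <- s) S i).
Proof.
move=> uS; have [L {}uS] := boolp.choice uS.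
exists (\sum_(i <- s) L i); split.
  by apply: has_csum_sum => i; have [] := uS i.
by rewrite -sumrB; apply: has_csum_sum => i; have [] := uS i.
Qed.

Lemma has_csumZ_shift1 u S : has_csumZ u S -> has_csumZ (fun r => u (r - 1)) S.
Proof.
case=> L [uL uR]; exists (L - u 0); split.
  apply: eq_has_csum (_ : has_csum (fun j => tail_nonpos u (1 + j)) _).
    by move=> j; rewrite /tail_nonpos; congr u; lia.
  by have := has_csum_drop 1 uL; rewrite big_ord1.
(* The term [u 0] leaves the left half and becomes the first of the right one. *)
rewrite opprB addrCA; have -> : u 0 = tail_gt 0 (fun r => u (r - 1)) 0.
  by rewrite /tail_gt; congr u; lia.
apply: has_csum_cons; apply: eq_has_csum uR => j.
by rewrite /tail_gt; congr u; lia.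
Qed.

Lemma has_csumZ_shift (m : nat) u S :
  has_csumZ u S -> has_csumZ (fun r => u (r - m%:Z)) S.
Proof.
move=> uS; elim: m => [|m IHm].
  by apply: eq_has_csumZ uS => r; congr u; lia.
by apply: eq_has_csumZ (has_csumZ_shift1 IHm) => r; congr u; lia.
Qed.

Lemma has_csumZ_split (n : nat) u S : has_csumZ u S -> exists L G,
  [/\ has_csum (tail_nonpos u) L, has_csum (tail_gt n u) G
    & \sum_(t < n) u t.+1%:Z + (L + G) = S].
Proof.
case=> L [uL uR]; exists L, (S - L - \sum_(t < n) u t.+1%:Z); split=> //.
  apply: eq_has_csum (has_csum_drop n uR) => j.
  by rewrite /tail_gt; congr u; lia.
by rewrite addrC addrA subrK addrC subrK.
Qed.

(** [|c r| <= |r * c r|] for every integer [r] except [0], whence the condition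
    on the enumeration [e]. *)
Lemma summable_half (c : int -> R) (e : nat -> int) :
  summable [set: int] (fun r => (r%:~R * c r)%:E) -> injective e ->
  (forall j, e j != 0) ->
  cvgn [normed series (fun j => c (e j))].
Proof.
move=> c_sum inj_e e_neq0.
pose g r := (`|(r%:~R * c r)%:E|)%E.
have sum_e : (\sum_(j <oo) g (e j) < +oo)%E.
  apply: le_lt_trans c_sum.
  rewrite -(esum_pred_image g e xpredT) => [|j _|i j _ _ /inj_e//]; last exact: abse_ge0.
  by rewrite esum_mkcond; apply: le_esum => r _; case: ifP.
have sc : cvgn (series (fun j => `|(e j)%:~R * c (e j)|)).
  by apply: nnseries_is_cvg => // j; exact: normr_ge0.
apply: (series_le_cvg _ _ _ sc) => //= j.
rewrite normrM ler_peMl// -intr_norm -[leLHS]/(1%:~R) ler_int.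
by have := e_neq0 j; lia.
Qed.

(** The weights [r] give no control of the term at [0], which is added back
    separately. *)
Lemma has_csumZ_expi (c : int -> R) (w : int -> R) :
  summable [set: int] (fun r => (r%:~R * c r)%:E) ->
  exists S, has_csumZ (fun r => (c r)%:C * expi (w r)) S.
Proof.
move=> c_sum.
have [L cL] : exists L, has_csum
    (fun j : nat => (c (- j.+1%:Z))%:C * expi (w (- j.+1%:Z))) L.
  apply: has_csum_expi (fun j => w (- j.+1%:Z)) _.
  by apply: summable_half c_sum _ _ => [i j|j]; lia.
have [G cG] : exists G, has_csum
    (fun j : nat => (c j.+1%:Z)%:C * expi (w j.+1%:Z)) G.
  apply: has_csum_expi (fun j => w j.+1%:Z) _.
  by apply: summable_half c_sum _ _ => [i j|j]; lia.
exists ((c 0)%:C * expi (w 0) + L + G); exists ((c 0)%:C * expi (w 0) + L); split.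
  exact: has_csum_cons.
by rewrite addrC addKr.
Qed.

End IntegerSeries.

(** * Fourier frequencies *)

Section Fourier.
Context {R : realType}.
Implicit Types x y w : R.

Lemma conj_expi x : ((expi x)^*)%R = expi (- x).
Proof. by rewrite /expi cosN sinN. Qed.

Lemma conj_real x : ((x%:C)^*)%R = x%:C :> R[i].
Proof. exact: conjc_real. Qed.

Lemma expi_mulrn x m : expi x ^+ m = expi (m%:R * x).
Proof.
elim: m => [|m IHm]; first by rewrite mul0r expi0.
by rewrite exprS IHm -expiD mulrS mulrDl mul1r.
Qed.

Lemma expi_omega n (k : 'I_n) : expi (n%:R * omega R k) = 1.
Proof.
have n0 : (n%:R : R) != 0 by rewrite pnatr_eq0 -lt0n (leq_ltn_trans _ (ltn_ord k)).
rewrite /omega mulrC divfK// mulrC -expi_mulrn; have -> : expi (2 * pi) = 1 :> R[i].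
  by rewrite mulrC mulr_natr /expi cos2pi sin2pi.
by rewrite expr1n.
Qed.

(** The half angle formula [cos x = 1 - 2 sin(x/2)^2] reduces this to the sign of
    the sine on [(0, pi)]. *)
Lemma expi_neq1 x : 0 < x < 2 * pi -> expi x != 1.
Proof.
move=> /andP[x0 x2pi]; apply/eqP => -[cosx _].
have : 0 < sin (x / 2) by apply: sin_gt0_pi; apply/andP; split; lra.
move: cosx; rewrite {1}[x]splitr cosD -!expr2 cos2sin2; nra.
Qed.

Lemma expi_omegaB_neq1 n (j k : 'I_n) : j != k -> expi (omega R j - omega R k) != 1.
Proof.
wlog jk : j k / (k < j)%N => [th|_].
  case: (ltngtP k j) => [kj|jk|/val_inj->]; last by rewrite eqxx.
    exact: th.
  move=> _; rewrite -opprB -conj_expi; have kj : k != j by rewrite -val_eqE neq_ltn jk orbT.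
  apply: contra (th k j jk kj) => /eqP e.
  by rewrite -[expi _]conjCK e conjC1.
have n0 : 0 < n%:R :> R by rewrite ltr0n (leq_ltn_trans _ (ltn_ord k)).
have pi0 := pi_gt0 R.
have -> : omega R j - omega R k = 2 * pi * (j - k)%:R / n%:R.
  by rewrite /omega -mulrBl -mulrBr -natrB ?subSS// ltnW.
apply: expi_neq1.
have jk0 : 0 < (j - k)%:R :> R by rewrite ltr0n subn_gt0.
rewrite divr_gt0 ?mulr_gt0//= ltr_pdivrMr// ltr_pM2l ?mulr_gt0// ltr_nat.
exact: leq_ltn_trans (leq_subr _ _) (ltn_ord j).
Qed.

(** Orthogonality of the Fourier vectors: this is a geometric sum whose ratio
    [e^{i (w_j - w_k)}] is an [n]-th root of unity, different from [1] off the
    diagonal. *)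
Lemma sum_expi_omega n (j k : 'I_n) :
  \sum_(t < n) expi (t.+1%:R * omega R j) * ((expi (t.+1%:R * omega R k))^*)%R
    = n%:R * (j == k)%:R.
Proof.
pose z : R[i] := expi (omega R j - omega R k).
under eq_bigr => t _ do rewrite conj_expi -expiD -mulrBr -expi_mulrn -/z.
have [jk|jk] := eqVneq j k.
  rewrite mulr1 {}/z jk subrr expi0.
  by under eq_bigr => t _ do rewrite expr1n; rewrite sumr_const card_ord.
have z1 : z != 1 by exact: expi_omegaB_neq1.
rewrite mulr0; apply/eqP; have := subrX1 z n.
rewrite expi_mulrn mulrBr expiD expi_omega mul1r -conj_expi expi_omega conjC1 subrr.
move=> /esym/eqP; rewrite mulf_eq0 subr_eq0 (negbTE z1) /= => /eqP s0.
by under eq_bigr => t _ do rewrite exprS; rewrite -mulr_sumr s0 mulr0.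
Qed.

(** The discrete Fourier matrix is invertible, its inverse being its conjugate
    transpose up to the factor [n]. *)
Lemma expi_omega_inj n (a : 'I_n -> R[i]) :
  (forall k : 'I_n, \sum_(t < n) a t * expi (t.+1%:R * omega R k) = 0) ->
  forall t, a t = 0.
Proof.
move=> a0 t.
pose E : 'M[R[i]]_n := \matrix_(k, s) expi (s.+1%:R * omega R k).
pose H : 'M[R[i]]_n := \matrix_(s, k) ((expi (s.+1%:R * omega R k))^*)%R.
have n0 : (n%:R : R[i]) != 0 by rewrite pnatr_eq0 -lt0n (leq_ltn_trans _ (ltn_ord t)).
have uE : E \in unitmx.
  have /mulmx1_unit[] // : E *m (n%:R^-1 *: H) = 1%:M.
  apply/matrixP => j k; rewrite -scalemxAr !mxE.
  under eq_bigr => s _ do rewrite !mxE.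
  by rewrite sum_expi_omega mulKf.
pose v : 'cV[R[i]]_n := \col_s a s.
have Ev : E *m v = 0.
  apply/colP => k; rewrite !mxE -[RHS](a0 k).
  by apply: eq_bigr => s _; rewrite !mxE mulrC.
have : v = 0 by rewrite -[v](mulKmx uE) Ev mulmx0.
by move/colP/(_ t); rewrite !mxE.
Qed.

End Fourier.

(** * Moments and linear prediction *)

Section Moments.
Context {d : measure_display} {T : measurableType d} {R : realType}.
Context {P : probability T R}.
Implicit Types Y Z : T -> R.

Definition mean Y : R := fine ('E_P[Y])%E.

Lemma mean_lin (I : Type) (s : seq I) (a : I -> R) (g : I -> T -> R) :
  (forall i, g i \in Lfun P 1) ->
  (fun x => \sum_(i <- s) a i * g i x) \in Lfun P 1 /\
  mean (fun x => \sum_(i <- s) a i * g i x)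
    = \sum_(i <- s) a i * mean (g i).
Proof.
move=> g1; elim: s => [|i s [IH1 IHE]].
  rewrite big_nil; under eq_fun => x do rewrite big_nil.
  by split; [exact: Lfun_cst | rewrite /mean (expectation_cst P 0)].
have ag : a i \o* g i \in Lfun P 1 by exact: Lfun_scale.
rewrite big_cons; have -> : (fun x => \sum_(j <- i :: s) a j * g j x)
    = ((a i \o* g i) \+ (fun x => \sum_(j <- s) a j * g j x))%R.
  by apply/funext => x; rewrite big_cons /= mulrC.
split; first exact: rpredD.
by rewrite /mean expectationD// fineD ?expectation_fin_num// expectationZl// fineM
  ?expectation_fin_num// -!/(mean _) IHE.
Qed.

Lemma cexpectation_lin (I : Type) (s : seq I) (z : I -> R[i]) (g : I -> T -> R) :
  (forall i, g i \in Lfun P 1) ->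
  cexpectation P (fun x => \sum_(i <- s) z i * (g i x)%:C)
    = \sum_(i <- s) z i * (mean (g i))%:C.
Proof.
move=> g1.
have sumE (v : I -> R) : \sum_(i <- s) z i * (v i)%:C
    = (\sum_(i <- s) complex.Re (z i) * v i)
      +i* (\sum_(i <- s) complex.Im (z i) * v i).
  elim: s => [|i s IHs]; first by rewrite !big_nil.
  rewrite !big_cons IHs; case: (z i) => p q; by simpc.
rewrite /cexpectation sumE.
have [_ <-] := mean_lin s (fun i => complex.Re (z i)) g1.
have [_ <-] := mean_lin s (fun i => complex.Im (z i)) g1.
congr (fine _ +i* fine _); congr ('E_P[_])%E; by apply/funext => x; rewrite sumE.
Qed.

Definition mom Y Z : R := mean (fun x => Y x * Z x).

Lemma momC Y Z : mom Y Z = mom Z Y.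
Proof. by congr (mean _); apply/funext => x; rewrite mulrC. Qed.

Lemma mom_ge0 Y : 0 <= mom Y Y.
Proof. by apply: fine_ge0; apply: expectation_ge0 => x; rewrite -expr2 sqr_ge0. Qed.

Lemma mom_lin (I : Type) (s : seq I) (a : I -> R) (Y : I -> T -> R) Z :
  (forall i, Y i \in Lfun P 2%:E) -> Z \in Lfun P 2%:E ->
  mom (fun x => \sum_(i <- s) a i * Y i x) Z = \sum_(i <- s) a i * mom (Y i) Z.
Proof.
move=> Y2 Z2.
have [_ <-] := mean_lin s a (fun i => Lfun2_mul_Lfun1 (Y2 i) Z2).
congr (mean _); apply/funext => x; rewrite mulr_suml.
by apply: eq_bigr => i _; rewrite mulrA.
Qed.

Lemma momDZ Y Y' Z (e : R) :
  Y \in Lfun P 2%:E -> Y' \in Lfun P 2%:E -> Z \in Lfun P 2%:E ->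
  mom (fun x => Y x + e * Y' x) Z = mom Y Z + e * mom Y' Z.
Proof.
move=> Y2 Y2' Z2.
have := @mom_lin bool [:: true; false] (fun b => if b then 1 else e)
  (fun b => if b then Y else Y') Z.
rewrite !big_cons !big_nil addr0 mul1r => <- //; last by case.
by congr (mom _ _); apply/funext => x; rewrite !big_cons !big_nil addr0 mul1r.
Qed.

Lemma Lfun2DZ Y Z (e : R) : Y \in Lfun P 2%:E -> Z \in Lfun P 2%:E ->
  (fun x => Y x + e * Z x) \in Lfun P 2%:E.
Proof.
move=> Y2 Z2; have eZ : e \o* Z \in Lfun P 2%:E by apply: Lfun_scale => //; lra.
have -> : (fun x => Y x + e * Z x) = (Y \+ e \o* Z)%R.
  by apply/funext => x /=; rewrite [Z x * e]mulrC.
by rewrite rpredD ?lee1n.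
Qed.

(** The first-order condition of least squares: as a function of [e] the second
    moment of [Y + e Z] is a quadratic polynomial with linear coefficient
    [2 E(Y Z)]. *)
Lemma mom_minimal Y Z : Y \in Lfun P 2%:E -> Z \in Lfun P 2%:E ->
  (forall e, mom Y Y <= mom (fun x => Y x + e * Z x) (fun x => Y x + e * Z x)) ->
  mom Y Z = 0.
Proof.
move=> Y2 Z2 min; set g := mom Y Z; set v := mom Z Z.
have v0 : 0 <= v by exact: mom_ge0.
have quad e : 0 <= e * (2 * g) + e ^+ 2 * v.
  have momr W : W \in Lfun P 2%:E ->
      mom W (fun x => Y x + e * Z x) = mom W Y + e * mom W Z.
    by move=> W2; rewrite momC momDZ// momC [mom Z W]momC.
  have := min e; rewrite momDZ ?Lfun2DZ// !momr//.
  rewrite [mom Z Y]momC -/g -/v; nra.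
(* The minimum is at [- g / v]; using [v + 1] also covers [v = 0]. *)
have := quad (- g / (v + 1)).
have -> : - g / (v + 1) * (2 * g) + (- g / (v + 1)) ^+ 2 * v
    = - (g ^+ 2 * (v + 2) / (v + 1) ^+ 2).
  by field; rewrite gt_eqF//; lra.
have w0 : 0 < (v + 2) / (v + 1) ^+ 2 by rewrite divr_gt0 ?exprn_gt0//; lra.
rewrite oppr_ge0 -mulrA pmulr_lle0// => g0.
by apply/eqP; rewrite -sqrf_eq0 eq_le g0 sqr_ge0.
Qed.

End Moments.
Arguments mom {d T R} P Y Z.

Section Stationary.
Context {d : measure_display} {T : measurableType d} {R : realType}.
Context {P : probability T R} {X : int -> {RV P >-> R}}.
Context (X_stat : second_order_stationary X).
Context (X_mean0 : forall t, ('E_P[X t] = 0)%E).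
Let c := autocov X.

Lemma stationary_Lfun2 t : (X t : T -> R) \in Lfun P 2%:E.
Proof. by case: X_stat. Qed.

Lemma mom_stationary s t : mom P (X s) (X t) = c (t - s).
Proof.
have [X2 _ cov] := X_stat.
have X1 r : (X r : T -> R) \in Lfun P 1 by apply: Lfun_subset12 => //; exact: fin_num_measure.
rewrite /c /autocov -[t - s]add0r (cov 0 s) addrC subrK.
by rewrite covarianceE ?X1 ?Lfun2_mul_Lfun1// !X_mean0 mule0 sube0.
Qed.

Lemma autocovN r : c (- r) = c r.
Proof. by rewrite -[r]subr0 -mom_stationary momC mom_stationary sub0r subr0. Qed.

Lemma lincomb_Lfun2 n (a : 'I_n -> R) : lincomb X a \in Lfun P 2%:E.
Proof.
have -> : lincomb X a = \sum_(t < n) (a t \o* (X t.+1%:Z : T -> R))%R.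
  by apply/funext => x; rewrite fct_sumE; apply: eq_bigr => t _; rewrite mulrC.
apply: (big_ind (fun Y => Y \in Lfun P 2%:E)) => [|Y Z Y2 Z2|t _].
- exact: Lfun_cst.
- by rewrite rpredD ?lee1n.
apply: Lfun_scale; first by lra.
exact: stationary_Lfun2.
Qed.

Lemma mom_lincomb n (a : 'I_n -> R) r :
  mom P (lincomb X a) (X r) = \sum_(t < n) a t * c (r - t.+1%:Z).
Proof.
rewrite /lincomb mom_lin; last 2 first.
- by move=> t; exact: stationary_Lfun2.
- exact: stationary_Lfun2.
by apply: eq_bigr => t _; rewrite mom_stationary.
Qed.

End Stationary.

Definition normal_eqs (R : realType) (c : int -> R) (n : nat) (tau : int)
    (a : 'I_n -> R) : Prop :=
  forall j : 'I_n, \sum_(t < n) a t * c (j.+1%:Z - t.+1%:Z) = c (j.+1%:Z - tau).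

Definition gram (R : realType) (c : int -> R) n : 'M[R]_n :=
  \matrix_(t, j) c (j.+1%:Z - t.+1%:Z).

(** The time reversal [t -> n + 1 - t] preserves the covariances because [c] is
    even; it turns backcasting of [X tau] into forecasting of [X (n + 1 - tau)]. *)
Lemma normal_eqs_rev (R : realType) (c : int -> R) (n : nat) (tau : int)
    (a : 'I_n -> R) : (forall r, c (- r) = c r) ->
  normal_eqs c tau a -> normal_eqs c (n.+1%:Z - tau) (fun t => a (rev_ord t)).
Proof.
move=> cN a_eqs j; rewrite (reindex_inj rev_ord_inj) /=.
rewrite -cN; have -> : - (j.+1%:Z - (n.+1%:Z - tau)) = (rev_ord j).+1%:Z - tau.
  by rewrite /=; have := ltn_ord j; lia.
rewrite -a_eqs; apply: eq_bigr => t _; rewrite rev_ordK -cN; congr (_ * c _).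
by rewrite /=; have := ltn_ord j; have := ltn_ord t; lia.
Qed.

Section Prediction.
Context {d : measure_display} {T : measurableType d} {R : realType}.
Context {P : probability T R} {X : int -> {RV P >-> R}}.
Context (X_stat : second_order_stationary X).
Context (X_mean0 : forall t, ('E_P[X t] = 0)%E).
Let c := autocov X.

(** Moving the coefficient of [X j] perturbs the prediction error by a multiple
    of [X j], so a minimizer has an error uncorrelated with every [X j]. *)
Lemma best_linear_normal_eqs n tau (a : 'I_n -> R) :
  best_linear_coef X tau a -> normal_eqs c tau a.
Proof.
move=> a_best j.
pose Y x := X tau x - lincomb X a x.
have X2 := stationary_Lfun2 X_stat.
have l2 (b : 'I_n -> R) := lincomb_Lfun2 X_stat b.
have YE (b : 'I_n -> R) x : X tau x - lincomb X b x = X tau x + (-1) * lincomb X b x.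
  by rewrite mulN1r.
have Y2 (b : 'I_n -> R) : (fun x => X tau x - lincomb X b x) \in Lfun P 2%:E.
  by rewrite (funext (YE b)); exact: Lfun2DZ.
have : mom P Y (X j.+1%:Z) = 0.
  apply: mom_minimal => // [|e]; first exact: Y2.
  pose b t := a t - e * (t == j)%:R.
  have bE x : Y x + e * X j.+1%:Z x = X tau x - lincomb X b x.
    rewrite /Y -addrA; congr (_ + _); rewrite /lincomb /b.
    under [in RHS]eq_bigr => t _ do rewrite mulrBl.
    rewrite sumrB opprB addrC; congr (_ - _); rewrite (bigD1 j)//= eqxx mulr1 big1 ?addr0// => t tj.
    by rewrite (negbTE tj) mulr0 mul0r.
  have fin (b' : 'I_n -> R) : ('E_P[fun x => ((X tau x - lincomb X b' x) ^+ 2)%R])%E \is a fin_num.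
    by apply: expectation_fin_num; exact: Lfun2_mul_Lfun1 (Y2 b') (Y2 b').
  rewrite (funext bE) -lee_fin /mom /mean !fineK; [exact: a_best | exact: fin..].
rewrite /Y (funext (YE a)) momDZ// mom_lincomb// mom_stationary//.
by move/eqP; rewrite mulN1r subr_eq0 => /eqP <-.
Qed.

Section Spectrum.
Context {f : R -> R} (f_spec : is_spectral_density c f).
Context (f_bdd : exists2 m : R, 0 < m & forall w, m <= f w).
Context (c_sum : summable [set: int] (fun r => (r%:~R * c r)%:E)).

Lemma spectral_has_csumZ w :
  has_csumZ (fun r => (c r)%:C * expi (r%:~R * w)) (f w)%:C.
Proof.
have [S cS] := has_csumZ_expi (fun r => r%:~R * w) c_sum.
by rewrite f_spec (has_csumZ_val cS).
Qed.

Lemma spectral_shift w (t : nat) :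
  has_csumZ (fun r => (c (r - t%:Z))%:C * expi (r%:~R * w))
    (expi (t%:R * w) * (f w)%:C).
Proof.
apply: eq_has_csumZ (has_csumZMl (expi (t%:R * w))
  (has_csumZ_shift t (spectral_has_csumZ w))) => r.
by rewrite mulrCA -expiD -mulrDl intrD rmorphN /= addrCA subrr addr0.
Qed.

(** A vector [a] in the kernel gives a combination [Y] of [X 1, ..., X n] with
    zero second moment, hence uncorrelated with [X r] for all integers [r] and
    not only for [1 <= r <= n].  The resulting identity [\sum_t a t * c (r - t) = 0]
    becomes [(\sum_t a t * e^{i t w}) * f w = 0] after multiplication by
    [e^{i r w}] and summation over [r]. *)
Lemma gram_injective n (a : 'I_n -> R) :
  (forall j : 'I_n, \sum_(t < n) a t * c (j.+1%:Z - t.+1%:Z) = 0) ->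
  forall t, a t = 0.
Proof.
move=> a0; have l2 := lincomb_Lfun2 X_stat a; have X2 := stationary_Lfun2 X_stat.
have Y0 : mom P (lincomb X a) (lincomb X a) = 0.
  rewrite [X in mom P X _]/lincomb mom_lin// big1// => t _.
  by rewrite momC mom_lincomb// a0 mulr0.
have aX r : \sum_(t < n) a t * c (r - t.+1%:Z) = 0.
  rewrite -mom_lincomb//; apply: mom_minimal => // e.
  by rewrite Y0 mom_ge0.
move=> t; suff /complexI : (a t)%:C = 0 by [].
move: t; apply: expi_omega_inj => k; set w := omega R k.
have fw0 : (f w)%:C != 0.
  have [m m0 mf] := f_bdd; rewrite gt_eqF// ltcR; exact: lt_le_trans (mf w).
apply/(mulIf fw0); rewrite mul0r mulr_suml.
have := has_csumZ_sum (index_enum 'I_n) (fun t : 'I_n =>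
  has_csumZMl (a t)%:C (spectral_shift w t.+1)).
under [in X in has_csumZ _ X]eq_bigr => t _ do rewrite mulrA.
move/has_csumZ_unique; apply.
have := has_csumZMl 0 (spectral_has_csumZ w); rewrite mul0r.
apply: eq_has_csumZ => r; under eq_bigr => t _ do rewrite mulrA -rmorphM.
by rewrite -mulr_suml -rmorph_sum aX !mul0r.
Qed.

Lemma gram_unit n : gram c n \in unitmx.
Proof.
rewrite -row_free_unit; apply/inj_row_free => v /rowP vG.
apply/rowP => t; rewrite [RHS]mxE; move: t; apply: gram_injective => j.
have := vG j; rewrite [RHS]mxE mxE => vGj; rewrite -[RHS]vGj.
by apply: eq_bigr => t _; rewrite mxE.
Qed.

(** Expresses the predictor through finitely many shifts of [c], from which it
    inherits its summability in [tau]. *)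
Lemma normal_eqs_solve n tau (a : 'I_n -> R) : normal_eqs c tau a ->
  forall t, a t = \sum_(j < n) invmx (gram c n) j t * c (tau - j.+1%:Z).
Proof.
have cN : forall r, c (- r) = c r := autocovN X_stat X_mean0.
move=> a_eqs t; pose v : 'rV[R]_n := \row_s a s.
have vG : v *m gram c n = \row_(j < n) c (tau - j.+1%:Z).
  apply/rowP => j; rewrite !mxE -cN opprB -a_eqs.
  by apply: eq_bigr => s _; rewrite !mxE.
have : v = (\row_(j < n) c (tau - j.+1%:Z)) *m invmx (gram c n).
  by rewrite -vG mulmxK// gram_unit.
move=> /rowP/(_ t); rewrite !mxE => ->.
by apply: eq_bigr => j _; rewrite mxE mulrC.
Qed.

End Spectrum.
End Prediction.

(** * The series completed by its predictors *)

Section Complete.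
Context {d : measure_display} {T : measurableType d} {R : realType}.
Context {P : probability T R} {X : int -> {RV P >-> R}}.
Context (X_stat : second_order_stationary X).
Context (X_mean0 : forall t, ('E_P[X t] = 0)%E).
Let c := autocov X.

Lemma ccov_lincomb n (a b : 'I_n -> R[i]) :
  ccov P (fun x => \sum_(t < n) a t * (X t.+1%:Z x)%:C)
         (fun x => \sum_(s < n) b s * (X s.+1%:Z x)%:C)
    = \sum_(s < n) ((b s)^*)%R * \sum_(t < n) a t * (c (s.+1%:Z - t.+1%:Z))%:C.
Proof.
have X2 := stationary_Lfun2 X_stat.
pose z (p : 'I_n * 'I_n) := ((b p.1)^*)%R * a p.2.
pose g (p : 'I_n * 'I_n) x := X p.2.+1%:Z x * X p.1.+1%:Z x.
have g1 p : g p \in Lfun P 1 by exact: (Lfun2_mul_Lfun1 (X2 _) (X2 _)).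
transitivity (cexpectation P (fun x => \sum_p z p * (g p x)%:C)).
  congr cexpectation; apply/funext => x.
  rewrite rmorph_sum mulr_sumr -(pair_bigA _ (fun s t => z (s, t) * (g (s, t) x)%:C)).
  apply: eq_bigr => s _; rewrite mulr_suml; apply: eq_bigr => t _.
  rewrite /z /g /= rmorphM /= conj_real rmorphM /=; ring.
rewrite cexpectation_lin// -(pair_bigA _ (fun s t => z (s, t) * (mean (g (s, t)))%:C)) /=.
apply: eq_bigr => s _; rewrite mulr_sumr; apply: eq_bigr => t _.
rewrite -mulrA; congr (_ * (_ * _%:C)).
exact: (mom_stationary X_stat X_mean0 t.+1%:Z s.+1%:Z).
Qed.

Context {f : R -> R} (f_spec : is_spectral_density c f).
Context (f_bdd : exists2 m : R, 0 < m & forall w, m <= f w).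
Context (c_sum : summable [set: int] (fun r => (r%:~R * c r)%:E)).
Context {n : nat} {phi : int -> 'I_n -> R}.
Context (phi_eqs : forall tau : int, (tau <= 0) || (n%:Z < tau) ->
  normal_eqs c tau (phi tau)).

(** The coefficient [e^{i t w} + L t + G t] is the total weight of [X t] in the
    Fourier transform of the completed series.  The last identity holds because
    the observed times and the two halves of unobserved times each contribute
    their part of the bilateral series [\sum_tau c (tau - s) e^{i tau w}], which
    the shift formula evaluates. *)
Lemma predictor_series w : exists L G : 'I_n -> R[i],
  [/\ forall t, has_csum
        (tail_nonpos (fun tau => (phi tau t)%:C * expi (tau%:~R * w))) (L t),
      forall t, has_csum
        (tail_gt n (fun tau => (phi tau t)%:C * expi (tau%:~R * w))) (G t)
    & forall s : 'I_n, \sum_(t < n) (expi (t.+1%:R * w) + (L t + G t))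
          * (c (s.+1%:Z - t.+1%:Z))%:C
        = expi (s.+1%:R * w) * (f w)%:C].
Proof.
have cN : forall r, c (- r) = c r := autocovN X_stat X_mean0.
pose u (j : 'I_n) tau : R[i] := (c (tau - j.+1%:Z))%:C * expi (tau%:~R * w).
have split_u j : exists LG : R[i] * R[i],
    [/\ has_csum (tail_nonpos (u j)) LG.1, has_csum (tail_gt n (u j)) LG.2
      & \sum_(t < n) u j t.+1%:Z + (LG.1 + LG.2) = expi (j.+1%:R * w) * (f w)%:C].
  have [L [G [uL uG LG]]] := has_csumZ_split n (spectral_shift f_spec c_sum w j.+1).
  by exists (L, G).
have {split_u} [LG split_u] := boolp.choice split_u.
pose mix (v : 'I_n -> R[i]) t := \sum_(j < n) (invmx (gram c n) j t)%:C * v j.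
have phiE tau t : (tau <= 0) || (n%:Z < tau) ->
    (phi tau t)%:C * expi (tau%:~R * w) = mix (u^~ tau) t.
  move=> /phi_eqs/(normal_eqs_solve X_stat X_mean0 f_spec f_bdd c_sum) ->.
  rewrite rmorph_sum mulr_suml; apply: eq_bigr => j _.
  by rewrite rmorphM /= mulrA.
have uE tau (s : 'I_n) : (tau <= 0) || (n%:Z < tau) ->
    \sum_(t < n) (c (s.+1%:Z - t.+1%:Z))%:C * ((phi tau t)%:C * expi (tau%:~R * w))
      = u s tau.
  move=> /phi_eqs/(_ s) e; rewrite /u -cN opprB -e rmorph_sum mulr_suml.
  by apply: eq_bigr => t _; rewrite rmorphM /= mulrCA mulrA.
(* [L] and [G] are the same combinations of the two halves of the shifted
   spectral series as the coefficients are of the shifts of [c]. *)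
exists (mix (fun j => (LG j).1)), (mix (fun j => (LG j).2)).
have uL j : has_csum (tail_nonpos (u j)) (LG j).1 by have [] := split_u j.
have uG j : has_csum (tail_gt n (u j)) (LG j).2 by have [] := split_u j.
have HL t : has_csum (tail_nonpos (fun tau => (phi tau t)%:C * expi (tau%:~R * w)))
    (mix (fun j => (LG j).1) t).
  apply: eq_has_csum (has_csum_sum (index_enum 'I_n) (fun j =>
    has_csumMl (invmx (gram c n) j t)%:C (uL j))) => i.
  by rewrite /tail_nonpos phiE//; lia.
have HG t : has_csum (tail_gt n (fun tau => (phi tau t)%:C * expi (tau%:~R * w)))
    (mix (fun j => (LG j).2) t).
  apply: eq_has_csum (has_csum_sum (index_enum 'I_n) (fun j =>
    has_csumMl (invmx (gram c n) j t)%:C (uG j))) => i.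
  by rewrite /tail_gt phiE//; lia.
split=> // s; have [_ _ <-] := split_u s.
under eq_bigr => t _ do rewrite mulrC mulrDr mulrDr.
rewrite !big_split /=; congr (_ + (_ + _)).
- apply: eq_bigr => t _; rewrite /u -cN opprB; congr (_%:C * expi (_ * _)).
- apply: has_csum_unique (uL s); apply: eq_has_csum (has_csum_sum (index_enum 'I_n)
    (fun t => has_csumMl (c (s.+1%:Z - t.+1%:Z))%:C (HL t))) => i.
  by rewrite /tail_nonpos uE//; lia.
- apply: has_csum_unique (uG s); apply: eq_has_csum (has_csum_sum (index_enum 'I_n)
    (fun t => has_csumMl (c (s.+1%:Z - t.+1%:Z))%:C (HG t))) => i.
  by rewrite /tail_gt uE//; lia.
Qed.

(** Both sides solve the same normal equations, whose solution is unique. *)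
Lemma phi_rev tau t : tau <= 0 -> phi tau (rev_ord t) = phi (n.+1%:Z - tau) t.
Proof.
move=> tau0; have cN : forall r, c (- r) = c r := autocovN X_stat X_mean0.
have solve := normal_eqs_solve X_stat X_mean0 f_spec f_bdd c_sum.
have /solve -> : normal_eqs c (n.+1%:Z - tau) (phi (n.+1%:Z - tau)).
  by apply: phi_eqs; lia.
have /(normal_eqs_rev cN)/solve -> // : normal_eqs c tau (phi tau).
by apply: phi_eqs; rewrite tau0.
Qed.

(** The reversed term of [Dterm] at [tau = - j] is the forecasting term at
    [n + 1 + j], because [e^{i n w} = 1] at a Fourier frequency. *)
Lemma tail_nonpos_Dterm (k t : 'I_n) j :
  tail_nonpos (Dterm phi k t) j
    = tail_nonpos (fun tau => (phi tau t)%:C * expi (tau%:~R * omega R k)) j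
      + tail_gt n (fun tau => (phi tau t)%:C * expi (tau%:~R * omega R k)) j.
Proof.
rewrite /tail_nonpos /tail_gt /Dterm phi_rev; last by lia.
have -> : n.+1%:Z - - j%:Z = (n.+1 + j)%:Z by lia.
congr (_ + _ * _).
rewrite -[LHS]mul1r -(expi_omega k) -expiD; congr expi.
rewrite -mulNr -mulrDl; congr (_ * _); rewrite -[n%:R]/(n%:Z%:~R) -rmorphN -rmorphD /=.
by congr (_%:~R); lia.
Qed.

End Complete.

Lemma rsqrtn_sqr (R : realType) n : (0 < n)%N ->
  ((rsqrtn R n)^*)%R * rsqrtn R n * n%:R = 1.
Proof.
move=> n0; rewrite /rsqrtn conj_real -rmorphM /=.
have -> : (n%:R : R[i]) = (n%:R)%:C by rewrite rmorph_nat.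
rewrite -rmorphM /= -expr2 exprVn sqr_sqrtr ?ler0n// mulVf ?pnatr_eq0 -?lt0n//.
Qed.

Theorem theorem2p1 (d : measure_display) (T : measurableType d) (R : realType)
    (P : probability T R) (X : int -> {RV P >-> R}) (f : R -> R)
    (X_stat : second_order_stationary X)
    (X_mean0 : forall t, ('E_P[X t] = 0)%E)
    (f_spec : is_spectral_density (autocov X) f)
    (f_bdd : exists2 m : R, 0 < m & forall w, m <= f w)
    (c_sum : summable [set: int] (fun r => (r%:~R * autocov X r)%:E))
    (n : nat) (n_gt0 : (0 < n)%N)
    (phi : int -> 'I_n -> R)
    (phi_best : forall tau : int, (tau <= 0) || (n%:Z < tau) ->
       best_linear_coef X tau (phi tau)) :
  [/\ forall k t, is_cvg_csum (tail_nonpos (Dterm phi k t)),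
      forall w x, is_cvg_csum (tail_nonpos (Jhat_term X phi w x)) /\
                  is_cvg_csum (tail_gt n (Jhat_term X phi w x)),
      ccov_mx P (fun x => (Fmx R n + Dmx phi) *m sample X n x)
                (fun x => Fmx R n *m sample X n x)
        = Deltamx n f &
      forall k1 k2 : 'I_n,
        ccov P (Jtilde X phi (omega R k1)) (J X n (omega R k2))
          = (f (omega R k1))%:C * (k1 == k2)%:R].
Proof.
have phi_eqs tau : (tau <= 0) || (n%:Z < tau) ->
    normal_eqs (autocov X) tau (phi tau).
  by move=> /phi_best; exact: best_linear_normal_eqs.
have /boolp.choice[L /boolp.choice[G LG]] :=
  predictor_series X_stat X_mean0 f_spec f_bdd c_sum phi_eqs.
(* Weights of the observations in [Jtilde] and in [J]. *)
pose A w (t : 'I_n) := rsqrtn R n * (expi (t.+1%:R * w) + (L w t + G w t)).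
pose B w (t : 'I_n) := rsqrtn R n * expi (t.+1%:R * w).
have uL w t : has_csum
    (tail_nonpos (fun tau => (phi tau t)%:C * expi (tau%:~R * w))) (L w t).
  by have [] := LG w.
have uG w t : has_csum
    (tail_gt n (fun tau => (phi tau t)%:C * expi (tau%:~R * w))) (G w t).
  by have [] := LG w.
have D_sum k t : has_csum (tail_nonpos (Dterm phi k t)) (L (omega R k) t + G (omega R k) t).
  apply: eq_has_csum (has_csumD (uL _ t) (uG _ t)) => j.
  by rewrite (tail_nonpos_Dterm X_stat X_mean0 f_spec f_bdd c_sum phi_eqs).
have J_sumL w x : has_csum (tail_nonpos (Jhat_term X phi w x))
    (\sum_(t < n) (X t.+1%:Z x)%:C * L w t).
  apply: eq_has_csum (has_csum_sum (index_enum 'I_n)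
    (fun t => has_csumMl (X t.+1%:Z x)%:C (uL w t))) => j.
  rewrite /tail_nonpos /Jhat_term /lincomb rmorph_sum mulr_suml.
  by apply: eq_bigr => t _; rewrite rmorphM /= mulrCA mulrA.
have J_sumG w x : has_csum (tail_gt n (Jhat_term X phi w x))
    (\sum_(t < n) (X t.+1%:Z x)%:C * G w t).
  apply: eq_has_csum (has_csum_sum (index_enum 'I_n)
    (fun t => has_csumMl (X t.+1%:Z x)%:C (uG w t))) => j.
  rewrite /tail_gt /Jhat_term /lincomb rmorph_sum mulr_suml.
  by apply: eq_bigr => t _; rewrite rmorphM /= mulrCA mulrA.
have JE w x : J X n w x = \sum_(t < n) B w t * (X t.+1%:Z x)%:C.
  by rewrite /J mulr_sumr; apply: eq_bigr => t _; rewrite /B -mulrA [expi _ * _]mulrC.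
have JtE w x : Jtilde X phi w x = \sum_(t < n) A w t * (X t.+1%:Z x)%:C.
  rewrite /Jtilde /Jhat (has_csum_val (J_sumL w x)) (has_csum_val (J_sumG w x)) JE.
  rewrite !mulr_sumr -!big_split; apply: eq_bigr => t _; rewrite /A /B /=; ring.
have FE k x : (Fmx R n *m sample X n x) k 0 = J X n (omega R k) x.
  by rewrite JE mxE; apply: eq_bigr => t _; rewrite !mxE.
have FDE k x : ((Fmx R n + Dmx phi) *m sample X n x) k 0 = Jtilde X phi (omega R k) x.
  rewrite JtE mxE; apply: eq_bigr => t _; rewrite !mxE (has_csum_val (D_sum k t)).
  by rewrite -mulrDr.
have main (k1 k2 : 'I_n) : ccov P (Jtilde X phi (omega R k1)) (J X n (omega R k2))
    = (f (omega R k1))%:C * (k1 == k2)%:R.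
  rewrite (funext (JE _)) (funext (JtE _)) (ccov_lincomb X_stat X_mean0).
  set w1 := omega R k1; set w2 := omega R k2.
  transitivity (((rsqrtn R n)^*)%R * rsqrtn R n * (f w1)%:C *
      \sum_(s < n) expi (s.+1%:R * w1) * ((expi (s.+1%:R * w2))^*)%R).
    rewrite mulr_sumr; apply: eq_bigr => s _.
    have [_ _ LGs] := LG w1.
    under eq_bigr => t _ do rewrite /A -mulrA.
    rewrite -mulr_sumr LGs /B rmorphM /=; ring.
  by rewrite sum_expi_omega mulrACA rsqrtn_sqr// mul1r.
split=> // [k t|w x|].
- exact: has_csum_cvg (D_sum k t).
- by split; [exact: has_csum_cvg (J_sumL w x) | exact: has_csum_cvg (J_sumG w x)].
apply/matrixP => k1 k2; rewrite !mxE -mulr_natr -main.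
congr cexpectation; apply/funext => x.
by rewrite mxE big_ord1 !mxE -[in RHS]FE -FDE !mxE.
Qed.
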